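(* Let $k,a,b,r$ be integers with $k\geq b>a\geq 1$ and $r\geq 1$. For $m\geq 1$, let $\mathcal{BP}_{a,b,k,r}(m)$ be the set of partitions $\pi=(\pi_1,\ldots,\pi_m)$ with exactly $m$ parts such that (1) each $\pi_i$ is congruent to $a$ or $b$ modulo $k$; (2) $\pi_m=a$ or $\pi_m=b$; (3) $\pi_i-\pi_{i+1}<k$ for $1\leq i<m$; (4) for $1\leq i\leq m-r$, if $\pi_{i+1}=\pi_{i+2}=\cdots=\pi_{i+r}\equiv b\pmod k$ then $\pi_i\equiv a\pmod k$. Then for $m\geq 1$, \begin{align*} &\sum_{\pi\in\mathcal{BP}_{a,b,k,r}(m)}\mu^{\ell_{k,a}(\pi)}\nu^{\ell_{k,b}(\pi)}q^{|\pi|}\\ &=\mu^mq^{ma}+\sum_{s\geq 1}\sum_{h\geq 0}\mu^{m-h-s}\nu^{h+s}q^{(m-h-s)a+(h+s)b+k(s^2-s)}g_{k,r}(h,s){{m-h-s+1}\brack {s}}_{k}, \end{align*} where $g_{k,r}(h,s)=\sum_{i\geq 0}(-1)^iq^{rk(i^2-i)/2}{{s}\brack {i}}_{rk}{{h-ri+s-1}\brack {s-1}}_{k}$.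
   Context: Partitions are non-increasing finite sequences of positive integers; $|\pi|$ is the sum of parts; $\ell_{k,d}(\pi)$ is the number of parts congruent to $d$ modulo $k$. $(x;q)_0=1$, $(x;q)_n=(1-x)\cdots(1-xq^{n-1})$. For a positive integer $k$ and integers $A,B$, ${A\brack B}_k=\frac{(q^k;q^k)_A}{(q^k;q^k)_B(q^k;q^k)_{A-B}}$ if $A\geq B\geq 0$, and $0$ otherwise. *)

(* Defs.v *)
From HB Require Import structures.
From mathcomp Require Import all_boot all_order all_algebra.
From mathcomp Require Import mathcomp_extra boolp classical_sets cardinality.
From mathcomp Require Import fsbigop mpoly zify.

Set Implicit Arguments.
Unset Strict Implicit.
Unset Printing Implicit Defensive.

Import Order.TTheory GRing.Theory Num.Theory.
Local Open Scope nat_scope.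

Definition is_partition (pi : seq nat) : bool :=
  sorted geq pi && all (fun x => 0 < x) pi.

(* Parts are numbered from 1, as in pi = (pi_1, ..., pi_m). *)
Definition part (pi : seq nat) (i : nat) : nat := nth 0 pi i.-1.

Definition ell (k d : nat) (pi : seq nat) : nat :=
  count (fun x => x == d %[mod k]) pi.

(* The difference in the third condition on parts is a truncated one, but the
   parts are non-increasing. *)
Definition BP (a b k r m : nat) : set (seq nat) :=
  [set pi | [/\ is_partition pi, size pi = m,
      forall i, 1 <= i <= m ->
        part pi i = a %[mod k] \/ part pi i = b %[mod k],
      part pi m = a \/ part pi m = b &
      (forall i, 1 <= i < m -> part pi i - part pi i.+1 < k) /\
      (forall i, 1 <= i -> i + r <= m ->
        (forall j, 1 <= j <= r -> part pi (i + j) = part pi i.+1) ->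
        part pi i.+1 = b %[mod k] ->
        part pi i = a %[mod k])]]%classic.

(* The sum over BP in the theorem is a finitely supported sum, whose value is
   meaningful because the index set is finite. *)
Lemma BP_finite a b k r m : finite_set (BP a b k r m).
Proof.
pose N := (m * k + a + b).+1.
pose f (t : m.-tuple 'I_N) : seq nat := [seq val i | i <- t].
apply: (@sub_finite_set _ _ [set f t | t in [set: m.-tuple 'I_N]]%classic);
  last exact/finite_image/finite_finset.
move=> pi /= [_ szpi _ last_pi [diff_pi _]].
have bound j : j < m -> part pi (m - j) <= j * k + a + b.
  elim: j => [|j IH] jm; first by rewrite subn0; lia.
  have {}IH := IH (ltnW jm).
  have := diff_pi (m - j.+1); have -> : (m - j.+1).+1 = m - j by lia.
  by move=> /(_ ltac:(lia)); rewrite mulSn; lia.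
have ltN i : i < m -> nth 0 pi i < N.
  move=> im; have := bound (m - i.+1) ltac:(lia).
  have -> : m - (m - i.+1) = i.+1 by lia.
  rewrite /part /= /N => /leq_ltn_trans; apply.
  by rewrite ltnS !leq_add2r leq_mul2r leq_subr orbT.
exists [tuple inord (nth 0 pi i) : 'I_N | i < m] => //.
apply: (@eq_from_nth _ 0); rewrite size_map size_tuple // => i im.
rewrite (nth_map ord0) ?size_tuple //.
by rewrite -(tnth_nth ord0 _ (Ordinal im)) tnth_mktuple /= inordK // ltN.
Qed.

Local Open Scope ring_scope.

Definition qpoch (F : comNzRingType) (x q : F) (n : nat) : F :=
  \prod_(i < n) (1 - x * q ^+ i).

(* The arguments A and B range over all integers, so that the symbol vanishes
   when, say, A is negative. *)
Definition qbinom (F : fieldType) (q : F) (k : nat) (A B : int) : F :=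
  if 0 <= B <= A then
    qpoch (q ^+ k) (q ^+ k) `|A|%N /
    (qpoch (q ^+ k) (q ^+ k) `|B|%N * qpoch (q ^+ k) (q ^+ k) `|A - B|%N)
  else 0.

(* Finitely supported sum: the summand vanishes for i > s. The division by 2
   is exact. *)
Definition g (F : fieldType) (q : F) (k r h s : nat) : F :=
  \sum_(i \in [set: nat])
     (-1) ^+ i * q ^+ (r * k * (i ^ 2 - i) %/ 2)%N
     * qbinom q (r * k) s%:Z i%:Z
     * qbinom q k (h%:Z - r%:Z * i%:Z + s%:Z - 1) (s%:Z - 1).

(* The generating functions live in the field of rational functions over the
   integers in three indeterminates. *)
Definition ratfun : fieldType := {fraction {mpoly int[3]}}.

Definition mu : ratfun := tofrac 'X_(@inord 2 0).
Definition nu : ratfun := tofrac 'X_(@inord 2 1).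
Definition q : ratfun := tofrac 'X_(@inord 2 2).

(* Main.v *)
Require Import Defs.
From HB Require Import structures.
From mathcomp Require Import all_boot all_order all_algebra.
From mathcomp Require Import mathcomp_extra boolp classical_sets cardinality.
From mathcomp Require Import fsbigop mpoly.
From mathcomp Require Import zify ring.

(** Put x = mu q^a, y = nu q^b and Q = q^k. A partition in BP is built from its
    smallest part upwards: after j k + a comes j k + a or j k + b, and after
    j k + b comes j k + b again (at most r copies in a row) or (j + 1) k + a.
    Splitting off the initial run of b-parts shows that x times the generating
    function of BP(n - 1) is C(n), where C(0) = 1 and
      C(n + 1) = x (C(n) + sum_(i < r) y^(i+1) Q^(n-i-1) C(n - i - 1)).
    On the other side, g(h, s) is the coefficient of Z^h in
      (Z^r; Q^r)_s / (Z; Q)_s = prod_(j < s) (1 + Z Q^j + ... + (Z Q^j)^(r-1)),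
    hence g(h, s + 1) = sum_(i < r) Q^(h-i) g(h - i, s); together with Pascal's
    rule for the Gaussian binomials this makes x times the right-hand side obey
    the same recurrence. *)

Set Implicit Arguments.
Unset Strict Implicit.
Unset Printing Implicit Defensive.
Import GRing.Theory.
Local Open Scope ring_scope.

(** * Multiplication by powers of Z on coefficient sequences *)

Section Shift.
Variable R : comNzRingType.

(** This models multiplication by Z^i. The explicit test matters: truncated subtraction would return
    [f 0] at indices below i. *)
Definition shift (i : nat) (f : nat -> R) (n : nat) : R :=
  if (i <= n)%N then f (n - i)%N else 0.

Lemma shift0 f n : shift 0 f n = f n.
Proof. by rewrite /shift subn0. Qed.

Lemma shiftSS i f n : shift i.+1 f n.+1 = shift i f n.
Proof. by rewrite /shift ltnS subSS. Qed.

Lemma shiftS0 i f : shift i.+1 f 0 = 0.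
Proof. by []. Qed.

Lemma shiftD i j f n : shift (i + j) f n = shift i (shift j f) n.
Proof.
rewrite /shift subnDA; case: (leqP i n) => h; last by rewrite ifF //; lia.
by rewrite leq_subRL.
Qed.

Lemma eq_shift i f f' n : f =1 f' -> shift i f n = shift i f' n.
Proof. by move=> ff'; rewrite /shift; case: ifP. Qed.

Lemma shift_sum (I : Type) (s : seq I) i (F : I -> nat -> R) n :
  shift i (fun n' => \sum_(j <- s) F j n') n = \sum_(j <- s) shift i (F j) n.
Proof. by rewrite /shift; case: ifP => // _; rewrite big1. Qed.

Lemma shiftZ i c f n : shift i (fun n' => c * f n') n = c * shift i f n.
Proof. by rewrite /shift; case: ifP; rewrite ?mulr0. Qed.

Lemma shiftB i f f' n :
  shift i (fun n' => f n' - f' n') n = shift i f n - shift i f' n.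
Proof. by rewrite /shift; case: ifP; rewrite ?subr0. Qed.

Lemma sum_shift i F n :
  \sum_(p < n.+1) shift i F p = shift i (fun n' => \sum_(p < n'.+1) F p) n.
Proof.
elim: i n => [|i IH] n.
  by rewrite shift0; apply: eq_bigr => p _; rewrite shift0.
rewrite big_ord_recl shiftS0 add0r; case: n => [|n]; first by rewrite big_ord0.
by rewrite shiftSS -IH; apply: eq_bigr => p _; rewrite -shiftSS.
Qed.

End Shift.

(** * Gaussian binomials and the two Pascal rules *)

Section Gauss.
Variable (R : comNzRingType) (Q : R).

(** Pascal's rule as definition avoids division, so the recurrences below hold over any commutative
    ring. *)
Fixpoint gauss (n m : nat) : R :=
  match n, m with
  | _, 0 => 1
  | 0, _.+1 => 0
  | n'.+1, m'.+1 => gauss n' m' + Q ^+ m * gauss n' m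
  end.

Lemma gaussn0 n : gauss n 0 = 1. Proof. by case: n. Qed.

Lemma gauss_small n m : (n < m)%N -> gauss n m = 0.
Proof.
elim: n m => [|n IH] [|m] //= h; rewrite !IH ?mulr0 ?addr0 //; lia.
Qed.

Lemma gaussnn n : gauss n n = 1.
Proof. by elim: n => //= n ->; rewrite gauss_small // mulr0 addr0. Qed.

Lemma gaussS n m : gauss n.+1 m.+1 = gauss n m + Q ^+ m.+1 * gauss n m.+1.
Proof. by []. Qed.

(** The companion rule follows by playing both rules against each other. For m > n the truncated
    exponent is harmless, since [gauss n m] is 0. *)
Lemma gaussS' n m : gauss n.+1 m.+1 = gauss n m.+1 + Q ^+ (n - m) * gauss n m.
Proof.
elim: n m => [|n IH] m.
  by rewrite gaussS sub0n expr0 mul1r mulr0 addr0 add0r.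
case: m => [|m].
  rewrite gaussS {1}IH [gauss n.+1 1]gaussS !gaussn0 !subn0 [Q ^+ n.+1]exprS; ring.
case: (leqP m n) => mn; last by rewrite !gauss_small ?mulr0 ?addr0 //; lia.
rewrite gaussS {1}IH {1}[gauss n.+1 m.+2]IH [gauss n.+1 m.+2]gaussS.
rewrite [gauss n.+1 m.+1]gaussS subSS.
case: (ltnP m n) => mn'.
  have -> : (n - m = (n - m.+1).+1)%N by lia.
  rewrite !exprS; ring.
rewrite [gauss n m.+1]gauss_small //.
ring.
Qed.
End Gauss.

(** * Coefficient recurrences on both sides *)

Section Coefficients.
Variables (R : comNzRingType) (Q : R) (r : nat).

(* Coefficient of Z^n in 1 / (Z; Q)_s. *)
Definition cser (s n : nat) : R :=
  if s is s'.+1 then gauss Q (n + s') s' else (n == 0)%:R.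

(* Coefficient of (Z^r)^i in (Z^r; Q^r)_s. *)
Definition eser (s i : nat) : R :=
  (-1) ^+ i * (Q ^+ r) ^+ 'C(i, 2) * gauss (Q ^+ r) s i.

Definition gcoef (s n : nat) : R :=
  \sum_(i < s.+1) eser s i * shift (r * i) (cser s) n.

(** (1 - Z) / (Z; Q)_(s+1) = 1 / (ZQ; Q)_s, and replacing Z by ZQ multiplies the coefficient of Z^n
    by Q^n. *)
Lemma cser_rec s n :
  cser s.+1 n - shift 1 (cser s.+1) n = Q ^+ n * cser s n.
Proof.
case: n => [|n]; first rewrite shiftS0 subr0 expr0 mul1r.
  by rewrite /= add0n gaussnn; case: s => //= s; rewrite add0n gaussnn.
rewrite shiftSS shift0; case: s => [|s]; first by rewrite /= !gaussn0 subrr mulr0.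
rewrite /cser addSn gaussS' addnS addSn (_ : (n + s).+1 - s = n.+1)%N; last by lia.
by rewrite addrC addKr.
Qed.

Lemma eser0 s : eser s 0 = 1.
Proof. by rewrite /eser gaussn0 bin0n !mulr1. Qed.

Lemma eser_rec s i : eser s.+1 i.+1 =
  (Q ^+ r) ^+ i.+1 * eser s i.+1 - (Q ^+ r) ^+ i * eser s i.
Proof. rewrite /eser gaussS binS bin1 exprD exprS; ring. Qed.

(* Coefficient of Z^n in (Z^r Q^r; Q^r)_s / (Z; Q)_(s+1). *)
Let B s n :=
  \sum_(i < s.+1) (Q ^+ r) ^+ i * eser s i * shift (r * i) (cser s.+1) n.

(** Splits the factor 1 - Z^r off (Z^r; Q^r)_(s+1). *)
Lemma gcoef_B s n : gcoef s.+1 n = B s n - shift r (B s) n.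
Proof.
rewrite /gcoef big_ord_recl eser0 mul1r.
under eq_bigr => i _ do rewrite lift0 eser_rec mulrBl.
rewrite sumrB addrA; congr (_ - _).
  transitivity (\sum_(i < s.+2)
     (Q ^+ r) ^+ i * eser s i * shift (r * i) (cser s.+1) n).
    by rewrite [RHS]big_ord_recl expr0 eser0 !mul1r.
  by rewrite big_ord_recr /= [eser s s.+1]/eser gauss_small // !mulr0 mul0r addr0.
rewrite /B shift_sum; apply: eq_bigr => i _.
by rewrite shiftZ mulnS shiftD.
Qed.

(** Multiplying by 1 - Z leaves (Z^r Q^r; Q^r)_s / (ZQ; Q)_s, the series of [gcoef s] at ZQ. *)
Lemma B_rec s n : B s n - shift 1 (B s) n = Q ^+ n * gcoef s n.
Proof.
rewrite /B shift_sum -sumrB mulr_sumr; apply: eq_bigr => i _.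
rewrite shiftZ -mulrBr -shiftD addnC shiftD -shiftB (eq_shift _ _ (cser_rec s)).
rewrite /shift; case: ifP => h; last by rewrite !mulr0.
have -> : Q ^+ n = Q ^+ (r * i) * Q ^+ (n - r * i) by rewrite -exprD subnKC.
rewrite -exprM; ring.
Qed.

(** Telescoping form of 1 - Z^r = (1 - Z)(1 + Z + ... + Z^(r-1)). *)
Lemma gcoef_rec s n :
  gcoef s.+1 n = \sum_(i < r) shift i (fun n' => Q ^+ n' * gcoef s n') n.
Proof.
(* Only the visible [r] is varied; the one inside [B] and [gcoef] stays fixed. *)
rewrite gcoef_B; elim: r => [|t IH]; first by rewrite big_ord0 shift0 subrr.
rewrite big_ord_recr /= -IH.
rewrite -(eq_shift _ _ (B_rec s)) shiftB -shiftD addn1; ring.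
Qed.

Lemma gcoef0 n : gcoef 0 n = (n == 0)%:R.
Proof. by rewrite /gcoef big_ord1 muln0 shift0 eser0 mul1r. Qed.

(** With p = h + s and N = m - p + 1 these are the coefficients of the theorem's right-hand side
    times x. The summand s = 0 survives only at p = 0 and accounts for the separate term mu^m
    q^(ma). *)
Definition Ecoef (N p : nat) : R :=
  \sum_(s < N.+1) Q ^+ (s ^ 2 - s) * shift s (gcoef s) p * gauss Q N s.

(** [gaussS'] splits each summand: the first halves rebuild [Ecoef N], and in the second halves,
    where s has dropped by one, [gcoef_rec] produces the sum over i. *)
Lemma Ecoef_rec N p : Ecoef N.+1 p =
  Ecoef N p + \sum_(i < r) shift i.+1 (fun n => Q ^+ (N + n) * Ecoef N n) p.
Proof.
rewrite {1}/Ecoef big_ord_recl gaussn0.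
under eq_bigr => s _ do rewrite lift0 gaussS' mulrDr.
rewrite big_split /= addrA; congr (_ + _).
  transitivity (\sum_(s < N.+2) Q ^+ (s ^ 2 - s) * shift s (gcoef s) p * gauss Q N s).
    by rewrite [RHS]big_ord_recl gaussn0.
  by rewrite big_ord_recr /= gauss_small // mulr0 addr0.
transitivity (\sum_(s < N.+1) \sum_(i < r)
  shift i.+1 (fun n => Q ^+ (N + n) *
    (Q ^+ (s ^ 2 - s) * shift s (gcoef s) n * gauss Q N s)) p).
  apply: eq_bigr => s _.
  rewrite (eq_shift _ _ (gcoef_rec s)) shift_sum mulr_sumr mulr_suml.
  apply: eq_bigr => i _.
  rewrite -shiftD addSnnS addnC /shift; case: ifP => h; last first.
    rewrite mulr0 mul0r; case: ifP => // h1.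
    by rewrite ifF; [rewrite mulr0 mul0r mulr0 | lia].
  rewrite ifT; last lia.
  rewrite ifT; last lia.
  rewrite (_ : p - (i.+1 + s) = p - i.+1 - s)%N; last lia.
  set u := gcoef _ _; set v := gauss _ _ _.
  transitivity (Q ^+ (s.+1 ^ 2 - s.+1 + (p - i.+1 - s) + (N - s)) * (u * v)).
    rewrite !exprD; ring.
  transitivity (Q ^+ (N + (p - i.+1) + (s ^ 2 - s)) * (u * v)).
    (* Raising s to s + 1 adds 2 s to s^2 - s, which cancels the two subtractions of s. *)
    congr (Q ^+ _ * _); have := ltn_ord s; nia.
  rewrite !exprD; ring.
rewrite exchange_big; apply: eq_bigr => i _.
by rewrite -shift_sum; apply: eq_shift => n; rewrite mulr_sumr.
Qed.

Lemma Ecoef0 p : Ecoef 0 p = (p == 0)%:R.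
Proof. by rewrite /Ecoef big_ord1 shift0 gcoef0 gaussn0 mulr1 mul1r. Qed.

Variables x y : R.

(* The coefficient of x^N y^p in C(N + p) is Ecoef N p. *)
Definition Cpoly (n : nat) : R :=
  \sum_(p < n.+1) x ^+ (n - p) * y ^+ p * Ecoef (n - p) p.

Lemma Cpoly0 : Cpoly 0 = 1.
Proof. by rewrite /Cpoly big_ord1 subn0 Ecoef0 !mulr1. Qed.

Lemma CpolyS n : Cpoly n.+1 =
  x * \sum_(p < n.+1) x ^+ (n - p) * y ^+ p * Ecoef (n - p).+1 p.
Proof.
rewrite /Cpoly big_ord_recr /= subnn Ecoef0 mulr0 addr0 mulr_sumr.
apply: eq_bigr => p _.
rewrite subSn; last by rewrite -ltnS.
rewrite exprS; ring.
Qed.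

Lemma Cpoly_rec n : Cpoly n.+1 =
  x * (Cpoly n + \sum_(i < r) y ^+ i.+1 *
                    shift i.+1 (fun n' => Q ^+ n' * Cpoly n') n).
Proof.
rewrite CpolyS; congr (_ * _).
under eq_bigr => p _ do rewrite Ecoef_rec mulrDr.
rewrite big_split; congr (_ + _).
under eq_bigr => p _ do rewrite mulr_sumr.
rewrite exchange_big; apply: eq_bigr => i _ /=.
(* The power of Q from [Ecoef_rec] has exponent (n - p) + (p - i - 1) = n - i - 1, independent of p,
   so it factors out of the sum. *)
pose F p := x ^+ (n - i.+1 - p) * y ^+ (p + i.+1) *
  (Q ^+ (n - i.+1) * Ecoef (n - i.+1 - p) p).
transitivity (\sum_(p < n.+1) shift i.+1 F p).
  apply: eq_bigr => p _; rewrite /shift; case: ifP => h; last by rewrite mulr0.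
  have pn : (p <= n)%N by rewrite -ltnS.
  rewrite /F !subnK // (_ : n - p + (p - i.+1) = n - i.+1)%N; last lia.
  by rewrite (_ : n - i.+1 - (p - i.+1) = n - p)%N; last lia.
rewrite sum_shift /shift; case: ifP => h; last by rewrite mulr0.
rewrite /Cpoly !mulr_sumr; apply: eq_bigr => p _.
rewrite /F exprD; ring.
Qed.

(* Total weight of the ways to add n larger parts to a partition whose largest
   part is j k + b, ending a run of t copies of it, if t > 0, and j k + a if
   t = 0. *)
Fixpoint W (n j t : nat) : R :=
  if n is n'.+1 then
    (if (t < r)%N then y * Q ^+ j * W n' j t.+1 else 0)
    + x * Q ^+ (j + (0 < t)) * W n' (j + (0 < t)) 0
  else 1.

(** Raising the level by j multiplies each of the n new parts by Q^j. In the second formula i counts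
    the further copies of j k + b before the next a-part, at level j + 1; when i = n no a-part
    follows, and C(0) = 1 covers this. *)
Lemma W_Cpoly n : (0 < r)%N ->
  (forall j, x * W n j 0 = Q ^+ (j * n) * Cpoly n.+1) /\
  (forall j t, (t < r)%N -> W n j t.+1 = Q ^+ (j * n) *
     \sum_(i < r - t) y ^+ i * shift i (fun n' => Q ^+ n' * Cpoly n') n).
Proof.
move=> r0; elim: n => [|n [IH0 IH1]].
  split=> [j|j t tr].
    rewrite Cpoly_rec muln0 Cpoly0 big1 ?addr0 /= ?mul1r ?mulr1 // => i _.
    by rewrite shiftS0 mulr0.
  rewrite (_ : r - t = (r - t.+1).+1)%N; last lia.
  rewrite big_ord_recl big1 => [|i _]; last by rewrite lift0 shiftS0 mulr0.
  by rewrite shift0 Cpoly0 muln0 !expr0 !mulr1 addr0 mulr1.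
split=> [j|j t tr].
  rewrite /= r0 addn0 IH1 // -[x * Q ^+ j * _]mulrA [Q ^+ j * W _ _ _]mulrC.
  rewrite [x * (W _ _ _ * _)]mulrA IH0.
  rewrite (Cpoly_rec n.+1) mulnS exprD subn0.
  under [X in _ = _ * (_ * (_ + X))]eq_bigr => i _ do rewrite shiftSS exprS -mulrA.
  rewrite -mulr_sumr; ring.
rewrite /= -mulrA addn1 [X in _ + X](_ : _ = Q ^+ j.+1 * (x * W n j.+1 0)); last ring.
rewrite IH0 (_ : r - t = (r - t.+1).+1)%N; last lia.
rewrite big_ord_recl shift0 expr0 mul1r mulrDr addrC; congr (_ + _).
  rewrite !mulrA -!exprD; congr (Q ^+ _ * _); lia.
case: ltnP => h; last by rewrite (_ : r - t.+1 = 0)%N ?big_ord0 ?mulr0 //; lia.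
rewrite IH1 //.
under [X in _ = _ * X]eq_bigr => i _ do rewrite lift0 shiftSS exprS -mulrA.
rewrite -mulr_sumr mulnS exprD; ring.
Qed.

End Coefficients.

(** * Building the partitions of BP part by part *)

Section Enumeration.
Variables k a b r : nat.
Local Open Scope nat_scope.

Definition isb (x : nat) : bool := x == b %[mod k].

Definition lead_b (p : seq nat) : nat := find (fun y => ~~ isb y) p.

(** Taking the predecessor puts j k + b at level j even when b = k. *)
Definition level (p : seq nat) : nat := if p is x :: _ then x.-1 %/ k else 0.

(* The empty partition behaves as if its largest part were a. *)
Definition next_parts (p : seq nat) : seq nat :=
  ((level p + (0 < lead_b p)) * k + a)
    :: (if lead_b p < r then [:: level p * k + b] else [::]).

Fixpoint chain (p : seq nat) : bool :=
  if p is x :: p' then chain p' && (x \in next_parts p') else true.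

Fixpoint chains (m : nat) : seq (seq nat) :=
  if m is m'.+1 then [seq x :: p | p <- chains m', x <- next_parts p]
  else [:: [::]].

Lemma level_part j d p : 0 < d <= k -> level (j * k + d :: p) = j.
Proof.
move=> /andP[d0 dk]; rewrite /level.
have -> : (j * k + d).-1 = j * k + d.-1 by lia.
by rewrite divnMDl ?divn_small ?addn0; lia.
Qed.

Lemma eq_mulk i j : i * k < j.+1 * k -> j * k < i.+1 * k -> i = j.
Proof. by rewrite !ltn_mul2r => /andP[_ ij] /andP[_ ji]; lia. Qed.

Lemma mod_part d x : 0 < d <= k -> 0 < x -> x = d %[mod k] ->
  exists i, x = i * k + d.
Proof.
move=> /andP[d0]; rewrite leq_eqVlt => /orP[/eqP dk|dk] x0 xd.
  have := divn_eq x k; rewrite xd dk modnn addn0.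
  case: (x %/ k) => [|i] xE; first by rewrite xE in x0.
  by exists i; rewrite {1}xE mulSn addnC.
by exists (x %/ k); rewrite {1}(divn_eq x k) xd (modn_small dk).
Qed.

Hypotheses (hbk : b <= k) (hab : a < b) (ha : 0 < a).

Lemma isb_a j : isb (j * k + a) = false.
Proof.
rewrite /isb modnMDl; apply/negbTE/eqP => ab.
have ak : a < k by exact: leq_trans hab hbk.
move: ab; rewrite modn_small //; move: hbk; rewrite leq_eqVlt => /orP[/eqP ->|bk].
  by rewrite modnn => a0; move: ha; rewrite a0.
by rewrite modn_small // => eab; move: hab; rewrite eab ltnn.
Qed.

Lemma isb_b j : isb (j * k + b).
Proof. by rewrite /isb modnMDl. Qed.

Lemma part_b_neq_a j : j * k + b == a %[mod k] = false.
Proof. by rewrite modnMDl eq_sym -(modnMDl 0) -/(isb _) isb_a. Qed.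

Lemma level_a j p : level (j * k + a :: p) = j.
Proof. by apply: level_part; rewrite ha (leq_trans (ltnW hab) hbk). Qed.

Lemma level_b j p : level (j * k + b :: p) = j.
Proof. by apply: level_part; rewrite hbk (leq_trans ha (ltnW hab)). Qed.

Lemma lead_b_a j p : lead_b (j * k + a :: p) = 0.
Proof. by rewrite /lead_b /= isb_a. Qed.

Lemma lead_b_b j p : lead_b (j * k + b :: p) = (lead_b p).+1.
Proof. by rewrite /lead_b /= isb_b. Qed.

Lemma chainsSP m z :
  reflect (exists p x, [/\ p \in chains m, x \in next_parts p & z = x :: p])
    (z \in chains m.+1).
Proof. exact: (@allpairsPdep _ (fun=> nat) _ (fun p x => x :: p)). Qed.

Lemma mem_chains m p : (p \in chains m) = chain p && (size p == m).
Proof.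
elim: m p => [|m IH] [|x p]; rewrite ?inE ?andbF //.
  by apply/negbTE/negP => /chainsSP[? [? []]].
apply/chainsSP/idP => [[p' [x' [mp' mx' [-> ->]]]]|].
  by move: mp'; rewrite IH /= eqSS => /andP[-> ->]; rewrite mx'.
move=> /andP[/andP[cp xp]]; rewrite eqSS => sp.
by exists p, x; split; rewrite ?IH ?sp ?andbT.
Qed.

Lemma uniq_next_parts p : uniq (next_parts p).
Proof.
rewrite /next_parts; case: ifP => //= _; rewrite inE andbT.
by apply/negP => /eqP e; have := isb_b (level p); rewrite -e isb_a.
Qed.

Lemma uniq_chains m : uniq (chains m).
Proof.
elim: m => // m IH.
have := @allpairs_uniq_dep _ (fun=> nat) _ (fun p x => x :: p) (chains m) next_parts IH.
apply; first by move=> p _; exact: uniq_next_parts.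
by move=> [p x] [p' x'] _ _ /= [-> ->].
Qed.

Lemma chain_head x p : chain (x :: p) ->
  x = level (x :: p) * k + (if isb x then b else a).
Proof.
move=> /= /andP[_]; rewrite /next_parts inE => /orP[/eqP ->|].
  by rewrite isb_a -/(level (_ :: p)) level_a.
case: ifP => // _; rewrite inE => /eqP ->.
by rewrite isb_b -/(level (_ :: p)) level_b.
Qed.

(** A b-part can only be placed on a b-part of the same level, so the initial b-parts all
    coincide. *)
Lemma chain_lead_b p i : chain p -> i < lead_b p -> nth 0 p i = nth 0 p 0.
Proof.
elim: p i => [|x p IH] [|i] //=.
rewrite {1}/lead_b /=; case: (boolP (isb x)) => //= bx /andP[cp xp].
rewrite ltnS => ip; rewrite IH //.
case: p cp ip xp {IH} => // y p cp ip; rewrite /next_parts inE => /orP[/eqP xE|].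
  by rewrite xE isb_a in bx.
case: ifP => // _; rewrite inE => /eqP ->.
have := chain_head cp; have -> // : isb y.
by move: ip; rewrite /lead_b /=; case: isb.
Qed.

Lemma lead_b_ge n p : n <= size p ->
  (forall i, i < n -> isb (nth 0 p i)) -> n <= lead_b p.
Proof.
move=> np bp; rewrite leqNgt; apply/negP => lt.
have := bp _ lt; have := @nth_find _ 0 (fun y => ~~ isb y) p.
by rewrite has_find (leq_trans lt np) => /(_ isT) /negbTE ->.
Qed.

Hypothesis hr : 0 < r.

(** The bounds y <= x < y + k leave exactly one level for each residue of x. *)
Lemma next_partsP x y p : chain (y :: p) ->
  reflect [/\ y <= x, x - y < k, x = a %[mod k] \/ x = b %[mod k] &
     (r <= size (y :: p) -> (forall j, j < r -> nth 0 (y :: p) j = y) ->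
      y = b %[mod k] -> x = a %[mod k])]
   (x \in next_parts (y :: p)).
Proof.
move=> cyp; have yE := chain_head cyp; set j := level _ in yE.
have runE := @chain_lead_b (y :: p) ^~ cyp.
have ak : 0 < a <= k by lia.
have bk : 0 < b <= k by lia.
have y0 : 0 < y by rewrite yE; case: ifP; lia.
have lE : (0 < lead_b (y :: p)) = isb y by rewrite /lead_b /=; case: isb.
rewrite /next_parts -/j lE; clearbody j; apply: (iffP idP) => [|[yx xyk xab xb]].
  rewrite inE => /orP[/eqP ->|].
    by split; rewrite ?modnMDl //; [case: isb yE; rewrite mulnDl; lia.. | left].
  case: ifP => // lt; rewrite inE => /eqP ->; split; rewrite ?modnMDl.
  - by case: isb yE; lia.
  - by case: isb yE; lia.
  - by right.
  - move=> rs ally yb; suff : r <= lead_b (y :: p) by rewrite leqNgt lt.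
    by apply: lead_b_ge => // i ir; rewrite ally // /isb yb.
have x0 : 0 < x := leq_trans y0 yx.
rewrite inE; case: (boolP (isb y)) yE => [by_|nby] yE.
  case: xab => [/(mod_part ak x0)|xb'].
    by move=> [i xE]; apply/orP; left; apply/eqP; rewrite xE; congr (_ * _ + _);
      apply: eq_mulk; rewrite ?addn1 !mulSn; clear - yE xE yx xyk ha hab hbk; lia.
  have [i xE] := mod_part bk x0 xb'.
  have ij : i = j by 
    apply: eq_mulk; rewrite !mulSn; clear - yE xE yx xyk ha hab hbk; lia.
  apply/orP; right; case: ltnP => lt; first by rewrite inE xE ij.
  (* A run of at least r copies of y would force x to be congruent to a, against its residue b. *)
  exfalso; have := isb_a i; rewrite /isb modnMDl => /eqP; apply.
  rewrite -xb' xb //; last by apply/eqP.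
    by apply: leq_trans lt _; exact: find_size.
  by move=> i' ir; rewrite runE //; exact: leq_trans ir lt.
have l0 : lead_b (y :: p) = 0 by rewrite /lead_b /= nby.
rewrite l0 hr addn0 inE; case: xab => [/(mod_part ak x0)|/(mod_part bk x0)] [i xE].
  by apply/orP; left; apply/eqP; rewrite xE; congr (_ * _ + _);
      apply: eq_mulk; rewrite ?addn1 !mulSn; clear - yE xE yx xyk ha hab hbk; lia.
by apply/orP; right; apply/eqP; rewrite xE; congr (_ * _ + _);
      apply: eq_mulk; rewrite ?addn1 !mulSn; clear - yE xE yx xyk ha hab hbk; lia.
Qed.

(** The largest part is peeled off: conditions at later indices belong to the tail, and those at
    index 1 are [next_partsP]. For a single part, the successors a and b of the empty partition
    express condition (2). *)
Lemma BP_chain p : 0 < size p -> BP a b k r (size p) p <-> chain p.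
Proof.
elim: p => // x [|y p] IH _.
  rewrite /BP /= /part /=; split.
    by move=> [_ _ _ xab _]; rewrite /next_parts /= !inE /= hr inE !add0n; lia.
  rewrite /next_parts /= !inE /= hr inE mul0n !add0n => xab.
  split=> //; [|move=> i im|lia|split=> i; lia].
    by rewrite /is_partition /= !andbT; lia.
  have -> : i = 1 by lia.
  by case/orP: xab => /eqP -> /=; [left|right].
have {}IH := IH isT; split.
  move=> [/andP[/= /andP[yx srt] /andP[x0 pos]] _ res lst [dif cond]].
  have cyp : chain (y :: p).
    apply/IH; split=> //; first by rewrite /is_partition /= srt pos.
    - by move=> [|i] // im; exact: (res i.+2 im).
    - split=> [[|i] // im|[|i] // i1 im]; first exact: (dif i.+2 im).
      exact: (cond i.+2).
  change (chain (y :: p) && (x \in next_parts (y :: p))); rewrite cyp /=.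
  apply/next_partsP => //; split => //.
  - exact: (dif 1).
  - exact: (res 1).
  - move=> rs ally yb; apply: (cond 1) => // [j jr].
    by rewrite /part add1n /=; move: (ally j.-1); case: j jr => // j jr /= -> //; lia.
move=> /andP[cyp]; rewrite -/(chain (y :: p)) in cyp.
move=> /(next_partsP x cyp)[yx xyk xab xb].
move/IH: cyp => [/andP[srt pos] _ res lst [dif cond]].
split=> //.
- rewrite /is_partition /= -/(sorted geq (y :: p)) yx; apply/andP; split=> //.
  by case/andP: (pos) => y0 _; rewrite (leq_trans y0 yx).
- move=> [|[|i]] // im; exact: (res i.+1 im).
split.
  move=> [|[|i]] // im; exact: (dif i.+1 im).
move=> [|[|i]] // i1 im.
  move=> eqy yb; apply: xb => // j jr; rewrite -[RHS](eqy j.+1); last lia.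
  by rewrite /part add1n.
exact: (cond i.+1).
Qed.

End Enumeration.

(** * The generating function as a transfer recursion *)

Section WeightedSum.
Variables (k a b r : nat) (R : comNzRingType) (u v z : R).
Hypotheses (hbk : (b <= k)%N) (hab : (a < b)%N) (ha : (1 <= a)%N).

Let wt p := u ^+ ell k a p * v ^+ ell k b p * z ^+ sumn p.
Let w := W (z ^+ k) r (u * z ^+ a) (v * z ^+ b).

Lemma wt_cons_a j p :
  wt ((j * k + a)%N :: p) = wt p * (u * z ^+ a * (z ^+ k) ^+ j).
Proof.
rewrite /wt /ell /= -/(isb k b _) isb_a // modnMDl eqxx add0n add1n !exprD exprS.
rewrite mulnC exprM; ring.
Qed.

Lemma wt_cons_b j p :
  wt ((j * k + b)%N :: p) = wt p * (v * z ^+ b * (z ^+ k) ^+ j).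
Proof.
rewrite /wt /ell /= part_b_neq_a // modnMDl eqxx add0n add1n !exprD exprS.
rewrite mulnC exprM; ring.
Qed.

Lemma sum_chainsS m (F : seq nat -> R) :
  \sum_(p <- chains k a b r m.+1) F p =
  \sum_(p <- chains k a b r m) \sum_(x <- next_parts k a b r p) F (x :: p).
Proof. exact: (@big_allpairs_dep _ _ _ _ (fun=> nat)). Qed.

(** One unfolding of [W] is a sum over the next part, so a part passes from the weight to the chain.
    Iterating leads from the empty chain to complete chains. *)
Lemma sum_chains_W m n :
  \sum_(p <- chains k a b r m) wt p * w n.+1 (level k p) (lead_b k b p) =
  \sum_(p <- chains k a b r m.+1) wt p * w n (level k p) (lead_b k b p).
Proof.
rewrite sum_chainsS; apply: eq_bigr => p _.
rewrite /next_parts big_cons wt_cons_a (level_a hbk hab) // lead_b_a // /w [W _ _ _ _ n.+1 _ _]/= addrC mulrDr.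
rewrite !mulrA; congr (_ + _).
case: ifP => _; last by rewrite big_nil mulr0.
by rewrite big_seq1 wt_cons_b (level_b hbk hab) // lead_b_b // !mulrA.
Qed.

Lemma sum_chains m : \sum_(p <- chains k a b r m) wt p = w m 0 0.
Proof.
suff H n : \sum_(p <- chains k a b r m) wt p * w n (level k p) (lead_b k b p)
   = w (m + n)%N 0 0.
  by rewrite -[in RHS](addn0 m) -H; apply: eq_bigr => p _; rewrite mulr1.
elim: m n => [|m IH] n; first by rewrite big_seq1 /wt !expr0 !mul1r.
by rewrite -sum_chains_W IH addSnnS.
Qed.

End WeightedSum.

(** * Gaussian binomials as quotients, and the identification of g *)

Section QBinomial.
Variables (F : fieldType) (z : F).
Hypothesis zN1 : forall n, z ^+ n.+1 != 1.

Lemma qpoch_neq0 k n : (0 < k)%N -> qpoch (z ^+ k) (z ^+ k) n != 0.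
Proof.
move=> k0; apply/prodf_neq0 => i _; rewrite -exprS -exprM subr_eq0 eq_sym.
by rewrite -(prednK k0) mulSn addSn.
Qed.

(** Induction by Pascal's rule, using 1 - Q^(n+1) = (1 - Q^(m+1)) + Q^(m+1) (1 - Q^(n-m)). *)
Lemma gauss_qpoch (Q : F) n m : (m <= n)%N ->
  gauss Q n m * (qpoch Q Q m * qpoch Q Q (n - m)) = qpoch Q Q n.
Proof.
have qpS i : qpoch Q Q i.+1 = qpoch Q Q i * (1 - Q ^+ i.+1).
  by rewrite /qpoch big_ord_recr /= -exprS.
elim: n m => [|n IH] [|m] // mn.
- by rewrite /qpoch !big_ord0 !mulr1.
- by rewrite gaussn0 subn0 {1}/qpoch big_ord0 !mul1r.
rewrite gaussS subSS mulrDl.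
move: mn; rewrite ltnS leq_eqVlt => /orP[/eqP ->|mn].
  rewrite (gauss_small _ (ltnSn n)) mulr0 mul0r addr0 gaussnn subnn.
  by rewrite {2}/qpoch big_ord0 mulr1 mul1r.
have nm : (n - m = (n - m.+1).+1)%N by lia.
rewrite -mulrA [X in _ + _ * X](_ : _ = qpoch Q Q n * (1 - Q ^+ (n - m))); last first.
  by rewrite -(IH m.+1) // {1}nm (qpS (n - m.+1)%N) -nm !mulrA.
rewrite {1}qpS [X in X + _](_ : _ = qpoch Q Q n * (1 - Q ^+ m.+1)); last first.
  by rewrite -(IH m (ltnW mn)); ring.
have -> : qpoch Q Q n.+1 = qpoch Q Q n * (1 - Q ^+ m.+1 * Q ^+ (n - m)).
  by rewrite qpS -exprD addSn subnKC // ltnW.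
ring.
Qed.

Lemma qbinom_gauss k n m : (0 < k)%N -> qbinom z k n%:Z m%:Z = gauss (z ^+ k) n m.
Proof.
move=> k0; rewrite /qbinom lez_nat le0z_nat /=; case: leqP => mn.
  rewrite subzn // !absz_nat -(gauss_qpoch _ mn) mulfK //.
  by rewrite mulf_neq0 // qpoch_neq0.
by rewrite gauss_small.
Qed.

Lemma fsbig_geq M N (f : nat -> F) : (forall i, (N <= i)%N -> f i = 0) ->
  \sum_(i \in [set i | (M <= i)%N]%classic) f i = \sum_(M <= i < N) f i.
Proof.
move=> f0; rewrite -(fsbig_widen [set` index_iota M N]%classic) /=.
- by rewrite -fsbig_seq ?iota_uniq.
- by move=> i /=; rewrite mem_index_iota => /andP[].
- move=> i [/= Mi] /negP; rewrite mem_index_iota Mi /= -leqNgt; exact: f0.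
Qed.

Lemma fsbig_nat N (f : nat -> F) : (forall i, (N <= i)%N -> f i = 0) ->
  \sum_(i \in [set: nat]) f i = \sum_(i < N) f i.
Proof.
move=> /(@fsbig_geq 0); rewrite big_mkord => <-.
by congr (\sum_(i \in _) f i); apply/seteqP; split.
Qed.

Lemma g_gcoef k r h s : (0 < k)%N -> (0 < r)%N ->
  g z k r h s.+1 = gcoef (z ^+ k) r s.+1 h.
Proof.
move=> k0 r0; rewrite /g (@fsbig_nat s.+2); last first.
  by move=> i si; rewrite qbinom_gauss ?muln_gt0 ?r0 // gauss_small // mulr0 mul0r.
apply: eq_bigr => i _; rewrite qbinom_gauss ?muln_gt0 ?r0 // /eser -[z ^+ k ^+ r]exprM.
rewrite (mulnC k r); congr (_ * _ * _ * _).
  rewrite -exprM; congr (z ^+ _).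
  have -> : (i ^ 2 - i = 'C(i, 2) * 2)%N.
    by elim: (val i) => // n; rewrite binS bin1 -!mulnn; nia.
  by rewrite !mulnA mulnK.
rewrite /shift; case: leqP => ih.
  rewrite (_ : _ - 1 = (h - r * i + s)%N%:Z); last lia.
  by rewrite (_ : s.+1%:Z - 1 = s) ?qbinom_gauss //; lia.
(* For r i > h the upper index h - r i + s lies below the lower index s, matching the default 0 of
   [shift]. *)
rewrite /qbinom ifF //; nia.
Qed.

End QBinomial.

(** * The right-hand side as a polynomial in x and y *)

Section RightHandSide.
Variables (F : fieldType) (u v z : F) (k a b r m : nat).
Hypotheses (zN1 : forall n, z ^+ n.+1 != 1) (k0 : (0 < k)%N) (r0 : (0 < r)%N).

Let Q := z ^+ k.
Let x := u * z ^+ a.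
Let y := v * z ^+ b.

Definition rhs_term (s h : nat) : F :=
  u ^ (m%:Z - h%:Z - s%:Z) * v ^+ (h + s)
        * z ^ ((m%:Z - h%:Z - s%:Z) * a%:Z + (h%:Z + s%:Z) * b%:Z
               + k%:Z * (s%:Z ^+ 2 - s%:Z))
        * g z k r h s
        * qbinom z k (m%:Z - h%:Z - s%:Z + 1) s%:Z.

(** Here m - h - s + 1 <= 0 < s, so the binomial vanishes and negative powers of [u] never
    contribute. *)
Lemma rhs_term_eq0 s h : (0 < s)%N -> (m < h + s)%N -> rhs_term s h = 0.
Proof.
move=> s0 mhs; rewrite /rhs_term [qbinom _ _ _ _]/qbinom ifF ?mulr0 //; lia.
Qed.

Let sterm s p :=
  x ^+ (m - p) * y ^+ p *
    (Q ^+ (s ^ 2 - s) * shift s (gcoef Q r s) p * gauss Q (m - p).+1 s).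

Lemma rhs_termE s h : (0 < s)%N -> (h + s <= m)%N ->
  rhs_term s h = sterm s (h + s).
Proof.
case: s => // s _ hsm; rewrite /rhs_term /sterm g_gcoef //.
rewrite {1}/shift leq_addl addnK.
have -> : m%:Z - h%:Z - s.+1%:Z = (m - (h + s.+1))%N%:Z by lia.
rewrite -[_%:Z + 1]/((_ + 1)%N%:Z) addn1 qbinom_gauss //.
rewrite (_ : s.+1%:Z ^+ 2 - s.+1%:Z = (s.+1 ^ 2 - s.+1)%N%:Z); last first.
  by rewrite -subzn // -mulnn leq_pmulr.
set n := (m - (h + s.+1))%N; set e := (s.+1 ^ 2 - s.+1)%N.
have -> : n%:Z * a%:Z + (h%:Z + s.+1%:Z) * b%:Z + k%:Z * e%:Z =
  (n * a + (h + s.+1) * b + k * e)%N%:Z by rewrite !PoszD !PoszM PoszD.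
set p := (h + s.+1)%N; clearbody n e p.
rewrite -!exprnP.
rewrite /x /y !exprMn !exprD /Q -!exprM !(mulnC _ a) !(mulnC _ b).
ring.
Qed.

Lemma rhs_inner s : (0 < s)%N ->
  \sum_(h \in [set: nat]) rhs_term s h = \sum_(p < m.+1) sterm s p.
Proof.
move=> s0; transitivity (\sum_(p < m.+1) shift s (rhs_term s) p); last first.
  apply: eq_bigr => p _; have pm : (p <= m)%N by rewrite -ltnS.
  rewrite {1}/shift; case: leqP => sp; last first.
    by rewrite /sterm /shift leqNgt sp /= mulr0 mul0r mulr0.
  by rewrite rhs_termE ?subnK.
rewrite sum_shift /shift; case: leqP => sm.
  by apply: fsbig_nat => h mh; apply: rhs_term_eq0 => //; lia.
rewrite (@fsbig_nat _ 0) ?big_ord0 // => h _; apply: rhs_term_eq0 => //; lia.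
Qed.

Lemma rhs_Cpoly :
  x * (u ^+ m * z ^+ (m * a)
    + \sum_(s \in [set s : nat | (1 <= s)%N]%classic)
         \sum_(h \in [set: nat]) rhs_term s h) = Cpoly Q r x y m.+1.
Proof.
rewrite CpolyS; congr (_ * _).
(* The range of s is extended to a bound independent of p, as [gauss] vanishes there, and the sums
   are exchanged. *)
have -> : \sum_(p < m.+1) x ^+ (m - p) * y ^+ p * Ecoef Q r (m - p).+1 p =
    \sum_(s < m.+2) \sum_(p < m.+1) sterm s p.
  rewrite exchange_big; apply: eq_bigr => p _.
  rewrite -mulr_sumr; congr (_ * _).
  have le : ((m - p).+2 <= m.+2)%N by rewrite !ltnS leq_subr.
  rewrite /Ecoef (big_ord_widen _ (fun s => Q ^+ (s ^ 2 - s)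
    * shift s (gcoef Q r s) p * gauss Q (m - p).+1 s) le) big_mkcond.
  apply: eq_bigr => s _; case: ltnP => // h.
  by rewrite gauss_small ?mulr0.
rewrite (@fsbig_geq _ 1 m.+2); last first.
  move=> s ms; rewrite (@fsbig_nat _ 0) ?big_ord0 // => h _.
  by apply: rhs_term_eq0; lia.
rewrite big_ord_recl big_add1 big_mkord; congr (_ + _); last first.
  by apply: eq_bigr => s _; rewrite rhs_inner // lift0.
(* For s = 0 only p = 0 survives, giving u^m z^(ma). *)
rewrite big_ord_recl big1 ?addr0 => [|p _]; last first.
  by rewrite /sterm shift0 gcoef0 lift0 mulr0 mul0r mulr0.
by rewrite /sterm shift0 gcoef0 gaussn0 subn0 !mulr1 /x exprMn -exprM mulnC.
Qed.

End RightHandSide.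

(** * Rational functions and conclusion *)

Lemma q_neq1 n : q ^+ n.+1 != 1.
Proof.
rewrite /q -tofracXn -tofrac1 tofrac_eq.
(* Evaluation at 0 would give 0 = 1. *)
apply/eqP => /(congr1 (meval (fun=> 0))).
by rewrite rmorphXn rmorph1 /= mevalXU expr0n.
Qed.

Lemma indeterminate_neq0 (i : 'I_3) : tofrac ('X_i : {mpoly int[3]}) != 0.
Proof.
rewrite tofrac_eq0; apply/eqP => /(congr1 (meval (fun=> 1))).
by rewrite mevalXU rmorph0.
Qed.

(* Both sums on the right are finitely supported: the last factor vanishes
   unless 2 * s + h <= m + 1. *)
Theorem theorem3p3 (k a b r : nat) (hbk : (b <= k)%N) (hab : (a < b)%N)
    (ha : (1 <= a)%N) (hr : (1 <= r)%N) (m : nat) (hm : (1 <= m)%N) :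
  \sum_(pi \in BP a b k r m)
     mu ^+ ell k a pi * nu ^+ ell k b pi * q ^+ sumn pi
  = mu ^+ m * q ^+ (m * a)
    + \sum_(s \in [set s : nat | (1 <= s)%N]) \sum_(h \in [set: nat])
        mu ^ (m%:Z - h%:Z - s%:Z) * nu ^+ (h + s)
        * q ^ ((m%:Z - h%:Z - s%:Z) * a%:Z + (h%:Z + s%:Z) * b%:Z
               + k%:Z * (s%:Z ^+ 2 - s%:Z))
        * g q k r h s
        * qbinom q k (m%:Z - h%:Z - s%:Z + 1) s%:Z.
Proof.
have k0 : (0 < k)%N by exact: leq_trans (leq_trans ha (ltnW hab)) hbk.
have -> : BP a b k r m = [set` chains k a b r m]%classic.
  apply/seteqP; split=> p /=; rewrite mem_chains.
    move=> bp; have sz : size p = m by case: bp.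
    rewrite sz eqxx andbT; apply/(BP_chain hbk hab ha hr); rewrite sz //.
  by move=> /andP[cp /eqP sz]; rewrite -sz; apply/(BP_chain hbk hab ha hr); rewrite ?sz.
rewrite -fsbig_seq ?uniq_chains // sum_chains //.
have x0 : mu * q ^+ a != 0 by rewrite mulf_neq0 ?expf_neq0 ?indeterminate_neq0.
(* After multiplication by x both sides equal C(m + 1), the left one by [W_Cpoly] at level 0. *)
apply: (mulfI x0); rewrite (rhs_Cpoly _ _ _ _ _ q_neq1) //.
by have [-> _] := W_Cpoly (q ^+ k) (mu * q ^+ a) (nu * q ^+ b) m hr; rewrite mul1r.
Qed.
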